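(* Let $\mathcal{G}$ be a connected graph on $N$ vertices with diameter $D$. If there exists a symmetric irreducible (entrywise) nonnegative matrix $M\in\mathcal{M}(\mathcal{G})$ satisfying the two conditions (I) $M\mathbf{1}=k\mathbf{1}$ for some $k\in\mathbb{R}$; (II) $M$ has only $D+1$ distinct eigenvalues, then there exist $D$ real matrices $A^{(1)},\dots,A^{(D)}\in\mathcal{M}(\mathcal{G})$ such that $A^{(D)}A^{(D-1)}\cdots A^{(1)}=\frac{1}{N}\mathbf{1}\mathbf{1}^{T}$.
   Context: Graphs are finite, simple and undirected. For a graph $\mathcal{G}=(\mathcal{V},\mathcal{E})$ with vertices $1,\dots,N$, the set of matrices that comply with $\mathcal{G}$ is $$\mathcal{M}(\mathcal{G}) = \{A=[a_{ij}]\in\mathbb{R}^{N\times N} : \text{for all } i\neq j,\ (i,j)\notin\mathcal{E} \Rightarrow a_{ij}=0\}.$$ The vector $\mathbf{1}\in\mathbb{R}^N$ is the column vector of ones. The diameter of a connected graph is the maximum, over pairs of vertices, of the length of a shortest path between them. A nonnegative matrix $B\in\mathbb{R}^{N\times N}$ is irreducible if and only if the digraph on $N$ nodes with arc set $\{(i,j) : B_{ji}>0\}$ is strongly connected. *)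

(* Defs.v *)
From mathcomp Require Import all_boot all_order all_algebra.
From mathcomp Require Import reals.

Set Implicit Arguments.
Unset Strict Implicit.
Unset Printing Implicit Defensive.

Import Order.TTheory GRing.Theory Num.Theory.
Local Open Scope ring_scope.

Section Distance.
Variables (T : finType) (e : rel T).

(* A path is listed as x :: p, so its length (number of edges) is size p. *)
Definition simple_path (x y : T) (p : seq T) : bool :=
  [&& path e x p, last x p == y & uniq (x :: p)].

(* A simple path has fewer than #|T| edges, so it suffices to minimise over
   n < #|T|; the value is the dummy #|T| when x and y are not connected. *)
Definition gdist (x y : T) : nat :=
  \big[minn/#|T|]_(n < #|T| | [exists p : n.-tuple T, simple_path x y p]) n.

Definition diameter : nat := \max_(x : T) \max_(y : T) gdist x y.

Lemma gdist_min x y p : simple_path x y p -> (gdist x y <= size p)%N.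
Proof.
move=> xp; have lt_p : (size p < #|T|)%N.
  by case/and3P: xp => _ _ /card_uniqP /= <-; exact: max_card.
have xt : [exists t : (size p).-tuple T, simple_path x y t].
  by apply/existsP; exists (in_tuple p).
rewrite /gdist -minEnat -leEnat.
exact: (bigmin_le_cond _ (fun n : 'I_#|T| => n : nat) (j := Ordinal lt_p)).
Qed.

Lemma gdist_attained x y :
  connect e x y -> exists2 p, simple_path x y p & size p = gdist x y.
Proof.
case/connectP=> q eq ->; case/shortenP: eq => p ep up _.
have xp : simple_path x (last x p) p by rewrite /simple_path ep eqxx.
have := gdist_min xp; set d := gdist _ _ => le_d.
have : d = #|T| \/ exists2 p', simple_path x (last x p) p' & size p' = d.
  rewrite /d /gdist; apply: (big_ind (fun d => d = #|T| \/
    exists2 p', simple_path x (last x p) p' & size p' = d)) => [|m n Hm Hn|n].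
  - by left.
  - by rewrite /minn; case: ifP.
  - by case/existsP=> t xt; right; exists (tval t); rewrite ?size_tuple.
case=> [dT|//]; move/card_uniqP: up => /= up.
by have := max_card (mem (x :: p)); rewrite up -dT ltnNge le_d.
Qed.

End Distance.

Section Matrices.
Variables (R : realType) (N : nat).

Definition simple_graph (e : rel 'I_N) : Prop := symmetric e /\ irreflexive e.

Definition connected_graph (e : rel 'I_N) : Prop :=
  forall i j : 'I_N, connect e i j.

Definition complies (e : rel 'I_N) (A : 'M[R]_N) : Prop :=
  forall i j : 'I_N, i != j -> ~~ e i j -> A i j = 0.

Definition nonneg_mx (A : 'M[R]_N) : Prop := forall i j, 0 <= A i j.

Definition irreducible_mx (B : 'M[R]_N) : Prop :=
  forall i j : 'I_N, connect (fun u v => 0 < B v u) i j.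

(* Only real eigenvalues are counted; those of a symmetric matrix are all
   real. *)
Definition num_distinct_eigenvalues (A : 'M[R]_N) (m : nat) : Prop :=
  exists s : seq R,
    [/\ uniq s, size s = m & forall a : R, eigenvalue A a <-> a \in s].

Definition ones : 'cV[R]_N := const_mx 1.

End Matrices.

Arguments ones {R N}.

(* Main.v *)
Require Import Defs.
From mathcomp Require Import all_boot all_order all_algebra.
From mathcomp Require Import reals.
From mathcomp Require Import spectral complex.

Set Implicit Arguments.
Unset Strict Implicit.
Unset Printing Implicit Defensive.

Import Order.TTheory GRing.Theory Num.Theory.
Local Open Scope ring_scope.

(* Since M is symmetric, the product of M - a over its D+1 eigenvalues a
   vanishes. Hence P, the product of the D factors (M - a) / (k - a) over the
   eigenvalues a != k, satisfies M P = P M = k P and P 1 = 1. By the maximum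
   principle the k-eigenvectors of the irreducible matrix M are constant, so all
   entries of P are equal, to 1/N because P 1 = 1. *)

(** Over the complex numbers [A] becomes Hermitian, so it is unitarily diagonalisable with a real
    diagonal. Each diagonal entry is an eigenvalue of [A] itself, hence a root of the product. *)
Lemma symmetric_horner_mx_eq0 (R : rcfType) (n : nat) (A : 'M[R]_n.+1)
    (s : seq R) :
  A^T = A -> (forall a, eigenvalue A a -> a \in s) ->
  horner_mx A (\prod_(a <- s) ('X - a%:P)) = 0.
Proof.
move=> symA eigA; set p := \prod_(a <- s) _.
pose f := real_complex R; pose Ac := map_mx f A.
have hermAc : Ac \is hermsymmx.
  apply/is_hermitianmxP; rewrite expr0 scale1r.
  by apply/matrixP => i j; rewrite !mxE -[in LHS]symA mxE; apply/esym/conjc_real.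
have /orthomx_spectralP := hermitian_normalmx hermAc.
set U := spectralmx Ac; set d := spectral_diag Ac => AcE.
have Uu : U \in unitmx := spectral_unit Ac.
apply: (@map_mx_inj _ _ f); rewrite map_horner_mx map_mx0 -/Ac AcE.
rewrite horner_mx_uconjC // horner_mx_diag.
suff -> : map_mx (horner (map_poly f p)) d = 0 by rewrite raddf0 mulmx0 mul0mx.
apply/rowP => i; rewrite !mxE.
have [a da] : exists a, d 0 i = f a.
  by apply/complex_realP; have /mxOverP := hermitian_spectral_diag_real hermAc.
rewrite da horner_map; suff /rootP -> : root p a by rewrite rmorph0.
rewrite root_prod_XsubC; apply: eigA.
rewrite -(eigenvalue_map f) -/Ac; apply/eigenvalueP.
(* Row [i] of [U] is a left eigenvector of [Ac] for the entry [d 0 i]; it is nonzero because [U] is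
   invertible. *)
exists (delta_mx 0 i *m U).
  rewrite {1}AcE !mulmxA mulmxK // -(rowE i (diag_mx d)) row_diag_mx da.
  by rewrite scalemxAl.
apply/eqP => /(congr1 (mulmx^~ (invmx U))); rewrite mulmxK // mul0mx.
by move/matrixP/(_ 0 i); rewrite !mxE !eqxx => /eqP; rewrite oner_eq0.
Qed.

(** Where a column of [B] is maximal, its value times [k] is a sum of the column with nonnegative
    weights of total [k], so every entry of positive weight is maximal too. *)
Lemma irreducible_eigenvectors_const (R : realType) (n p : nat) (M : 'M[R]_n)
    (k : R) (B : 'M[R]_(n, p)) :
  irreducible_mx M -> nonneg_mx M -> M *m ones = k *: ones ->
  M *m B = k *: B -> forall i i' j, B i j = B i' j.
Proof.
move=> irrM ge0M M1 MB i i' j.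
have [m _ max_m] := @Order.TotalTheory.arg_maxP _ _ _ i xpredT (B^~ j) isT.
suff eqm u : B u j = B m j by rewrite !eqm.
have step v : B v j = B m j -> forall u, 0 < M v u -> B u j = B m j.
  move=> Bv {}u Mvu.
  have sumM : \sum_w M v w = k.
    have /colP/(_ v) := M1; rewrite !mxE mulr1 => <-.
    by apply: eq_bigr => w _; rewrite mxE mulr1.
  have sum0 : \sum_w M v w * (B m j - B w j) = 0.
    under eq_bigr do rewrite mulrBr.
    rewrite sumrB -mulr_suml sumM.
    by have /matrixP/(_ v j) := MB; rewrite !mxE Bv => ->; rewrite subrr.
  have ge0 w : true -> 0 <= M v w * (B m j - B w j).
    by move=> _; rewrite mulr_ge0 ?subr_ge0 //; apply: max_m.
  have /eqP := psumr_eq0P ge0 sum0 (i := u) isT.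
  by rewrite mulf_eq0 gt_eqF // subr_eq0 => /eqP.
(* An arc from [u] to [w] means [0 < M w u], so maximality travels backwards along the path, from
   its end [m] to its start. *)
have /connectP[q] := irrM u m.
elim: q u => [|w q IHq] u /=; first by move=> _ ->.
by case/andP => Mwu /IHq{}IHq /IHq Bw; apply: step Bw _ Mwu.
Qed.

Theorem corollary4 (R : realType) (N : nat) (e : rel 'I_N) (D : nat)
  (e_simple : simple_graph e) (e_conn : connected_graph e)
  (e_diam : diameter e = D) :
  (exists M : 'M[R]_N,
     [/\ M^T = M, irreducible_mx M, nonneg_mx M & complies e M] /\
     (exists k : R, M *m ones = k *: ones) /\
     num_distinct_eigenvalues M D.+1) ->
  exists A : 'I_D -> 'M[R]_N,
    (forall i : 'I_D, complies e (A i)) /\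
    \big[mulmx/1%:M]_(i < D) A (rev_ord i) =
      N%:R^-1 *: (ones *m ones^T).
Proof.
move=> [M [[symM irrM ge0M eM] [[k M1] [s [uniq_s size_s eig_s]]]]].
(* Ring products and [horner_mx] are used in size [n.+1]; for [N = 0] all matrices coincide. *)
case: N => [|n] in e e_simple e_conn e_diam M symM irrM ge0M eM M1 eig_s *.
  by exists (fun=> 0); split=> [i [] //|]; apply/matrixP => -[].
have ks : k \in s.
  (* Eigenvectors are rows here, so symmetry of [M] turns [M1] into a statement on [ones^T]. *)
  apply/eig_s/eigenvalueP; exists ones^T.
    by rewrite -[M in LHS]symM -trmx_mul M1 linearZ.
  by apply/eqP => /matrixP/(_ 0 0); rewrite !mxE => /eqP; rewrite oner_eq0.
have perm_s := perm_to_rem ks; pose s' := rem k s.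
have size_s' : size s' = D by rewrite size_rem // size_s.
(* [M - a] multiplies [ones] by [k - a], so the scaling makes [F a] fix [ones]; [k] is not in [s']
   because [s] has no duplicates. *)
pose F a := (k - a)^-1 *: (M - a%:M).
(* This reversal cancels the one in the product. Compliance concerns off-diagonal entries only,
   which subtracting [a%:M] leaves unchanged. *)
exists (fun i => F s'`_(rev_ord i)); split=> [i u v neq_uv not_euv|].
  by rewrite !mxE (negPf neq_uv) eM // subrr mulr0.
under eq_bigr do rewrite rev_ordK.
have -> : \big[mulmx/1%:M]_(i < D) F s'`_i = \prod_(a <- s') F a.
  by rewrite (big_nth 0) big_mkord size_s'.
set P := \prod_(a <- s') F a.
have neq_k a : a \in s' -> k - a != 0.
  by move=> as'; apply: contraTneq as' => /subr0_eq <-; rewrite mem_rem_uniqF.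
have P1 : P *m ones = ones :> 'cV_n.+1.
  rewrite /P big_seq; apply: (big_ind (fun A => A *m ones = ones :> 'cV_n.+1)).
  - exact: mul1mx.
  - by move=> A B A1 B1; rewrite -mulmxA B1.
  move=> a as'; rewrite -scalemxAl mulmxBl M1 mul_scalar_mx -scalerBl scalerA.
  by rewrite mulVf ?scale1r ?neq_k.
pose p := \prod_(a <- s') ((k - a)^-1 *: ('X - a%:P)).
have PE : P = horner_mx M p.
  rewrite rmorph_prod; apply: eq_bigr => a _.
  by rewrite /= linearZ rmorphB /= horner_mx_X horner_mx_C.
have p0 : horner_mx M (('X - k%:P) * p) = 0.
  rewrite /p scaler_prod -scalerAr linearZ /=.
  have -> : ('X - k%:P) * \prod_(a <- s') ('X - a%:P) =
            \prod_(a <- s) ('X - a%:P).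
    by rewrite (perm_big _ perm_s) big_cons.
  by rewrite symmetric_horner_mx_eq0 ?scaler0 // => a /eig_s.
have MP : M *m P = k *: P.
  move: p0; rewrite rmorphM /= -PE rmorphB /= horner_mx_X horner_mx_C mulrBl.
  by rewrite -[_%:M * _]/(k%:M *m P) mul_scalar_mx => /subr0_eq.
have PM : P *m M = k *: P.
  move: p0; rewrite mulrC rmorphM /= -PE rmorphB /= horner_mx_X horner_mx_C mulrBr.
  by rewrite -[_ * _%:M]/(P *m k%:M) mul_mx_scalar => /subr0_eq.
have col_const := irreducible_eigenvectors_const irrM ge0M M1 MP.
(* Transposing [P M = k P] makes the columns of [P^T] eigenvectors of the symmetric [M]. *)
have row_const i j j' : P i j = P i j'.
  have := irreducible_eigenvectors_const irrM ge0M M1 (B := P^T).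
  rewrite -[M in M *m P^T]symM -trmx_mul PM linearZ /=.
  by move=> /(_ erefl j j' i); rewrite !mxE.
apply/matrixP => i j; rewrite !mxE big_ord1 !mxE !mulr1.
(* Row [i] of [P] sums to 1 and has [n.+1] equal entries. *)
have /colP/(_ i) := P1; rewrite !mxE => Pi1.
have n0 : n.+1%:R != 0 :> R by rewrite pnatr_eq0.
apply: (mulfI n0); rewrite mulfV // -[RHS]Pi1.
under eq_bigr do rewrite mxE mulr1 (row_const _ _ j).
by rewrite sumr_const card_ord mulr_natl.
Qed.
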